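(* The expressibility problem for iterative propositional calculi is algorithmically undecidable: there is no algorithm which, given two arbitrary iterative propositional calculi $P_1$ and $P_2$, decides whether $P_1\le P_2$, i.e. whether $[P_1]\subseteq [P_2]$.
   Context: Let $\mathcal{V}$ be a countably infinite set of propositional variables and $\Sigma$ a finite set of logical connectives (the signature; typically the connectives are unary or binary, e.g. $\neg,\vee,\wedge,\to$), containing the binary connective $\to$. $\Sigma$-formulas are built from variables and connectives of $\Sigma$ in the usual way. An iterative propositional calculus $P$ over $\Sigma$ consists of a finite set $P$ of $\Sigma$-formulas, called axioms, together with two inference rules: (1) modus ponens: from $A$ and $A\to B$ infer $B$; (2) superposition (the system of Maltsev operations): from $A(x)$ and $B$ infer $A(B)$, where $x$ is a variable and $A(B)$ is obtained by replacing all occurrences of $x$ in $A$ by $B$ (so the substituted formula $B$ must itself already be derived); the Maltsev operations also include renaming and identification of variables, i.e. from $A(x)$ one may infer $A(y)$ for any variables $x,y$. $[P]$ denotes the set of all formulas derivable from the axioms $P$ by finitely many applications of these rules. One writes $P_1\le P_2$ if every formula derivable in $P_1$ is derivable in $P_2$, i.e. $[P_1]\subseteq[P_2]$. *)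

(* Defs.v *)
From HB Require Import structures.
From mathcomp Require Import all_boot.
Set Implicit Arguments.
Unset Strict Implicit.
Unset Printing Implicit Defensive.

(** * Formulas *)

Record signature := Signature {
  connective :> finType;
  arity : connective -> nat;
  imp : connective;
  arity_imp : arity imp = 2 }.

Unset Elimination Schemes.
Inductive form (S : signature) :=
| Var of nat
| Con (c : S) of {ffun 'I_(arity c) -> form S}.
Set Elimination Schemes.
Arguments Var {S} x.
Arguments Con {S} c f.

(* The automatic scheme gives no induction hypothesis for the subformulas
   stored in a finite function. *)
Lemma form_ind (S : signature) (K : form S -> Prop) :
    (forall x, K (Var x)) ->
    (forall (c : S) (f : {ffun 'I_(arity c) -> form S}),
       (forall i, K (f i)) -> K (Con c f)) ->
  forall A, K A.
Proof.
move=> KV KC; fix IH 1 => -[x | c f]; first exact: KV.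
by apply: KC => i; apply: IH.
Qed.

(* The arguments are selected by the numerical value of the index, so that no
   cast along [arity_imp] is needed. *)
Definition Imp (S : signature) (A B : form S) : form S :=
  Con (imp S) [ffun i : 'I_(arity (imp S)) => if val i == 0 then A else B].

Fixpoint subst (S : signature) (x : nat) (B A : form S) : form S :=
  match A with
  | Var y => if y == x then B else Var y
  | Con c f => Con c [ffun i => subst x B (f i)]
  end.

(** * Gödel numbering *)

Definition npair (m n : nat) : nat := (m + n) ^ 2 + m.

Definition code_seq (s : seq nat) : nat :=
  foldr (fun x n => (npair x n).+1) 0 s.

Fixpoint code (S : signature) (A : form S) : nat :=
  match A with
  | Var x => npair 0 x
  | Con c f =>
      npair (enum_rank c).+1
            (code_seq [seq code (f i) | i <- enum 'I_(arity c)])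
  end.

Lemma npair_inj m n m' n' : npair m n = npair m' n' -> m = m' /\ n = n'.
Proof.
have lt_sq a b c d : a + b < c + d -> npair a b < npair c d.
  move=> lt_s; apply: leq_trans (leq_addr _ _).
  apply: (@leq_trans ((a + b).+1 ^ 2)); last by rewrite leq_sqr.
  rewrite /npair -(addn1 (a + b)) (sqrnD (a + b) 1) -addnA ltn_add2l muln1.
  by rewrite add1n ltnS mul2n -addnn -addnA leq_addr.
move=> E; have Es : m + n = m' + n'.
  by case: (ltngtP (m + n) (m' + n')) => // /lt_sq; rewrite E ltnn.
move: E; rewrite /npair Es => /addnI Em; split=> //.
by move: Es; rewrite Em => /addnI.
Qed.

Lemma code_seq_inj : injective code_seq.
Proof.
elim=> [|x s IH] [|y t] //= [] /npair_inj[-> /IH ->] //.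
Qed.

Lemma code_inj (S : signature) : injective (@code S).
Proof.
elim=> [x | c f IH] [y | d g] /= /npair_inj[] //; first by move=> _ ->.
case=> /val_inj/enum_rank_inj Ecd; case: d / Ecd g => g.
move=> /code_seq_inj Efg.
congr Con; apply/ffunP=> i; apply: IH.
by move/eq_in_map: Efg; apply; rewrite mem_enum.
Qed.

HB.instance Definition _ (S : signature) :=
  hasDecEq.Build (form S) (inj_eqAxiom (@code_inj S)).

(** * Iterative propositional calculi *)

(* A finite set of axioms is presented by a list; derivability depends only on
   its set of members. *)
Definition calculus (S : signature) := seq (form S).

Inductive derivable (S : signature) (P : calculus S) : form S -> Prop :=
| der_axiom A : A \in P -> derivable P A
| der_mp A B : derivable P A -> derivable P (Imp A B) -> derivable P B
| der_superposition x A B :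
    derivable P A -> derivable P B -> derivable P (subst x B A)
| der_rename x y A : derivable P A -> derivable P (subst x (Var y) A).

Definition calc_le (S : signature) (P1 P2 : calculus S) : Prop :=
  forall A, derivable P1 A -> derivable P2 A.

Definition code_calculus (S : signature) (P : calculus S) : nat :=
  code_seq [seq code A | A <- P].

Lemma code_calculus_inj (S : signature) : injective (@code_calculus S).
Proof. by move=> P Q /code_seq_inj /(inj_map (@code_inj S)). Qed.

(** * Algorithms: Kleene's partial recursive functions *)

Inductive murec : nat -> Type :=
| Zero : murec 0
| Succ : murec 1
| Proj n (i : 'I_n) : murec n
| Comp m n (f : murec m) (g : 'I_m -> murec n) : murec n
| Prec n (f : murec n) (g : murec n.+2) : murec n.+1
| Mu n (f : murec n.+1) : murec n.

(* [computes f v y] : [f] is defined at [v], with value [y].  In the [Prec]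
   case [s k] is the value at recursion argument [k], and [g] receives [k],
   [s k] and the parameters, in this order. *)
Fixpoint computes n (f : murec n) : n.-tuple nat -> nat -> Prop :=
  match f in murec n return n.-tuple nat -> nat -> Prop with
  | Zero => fun _ y => y = 0
  | Succ => fun v y => y = (thead v).+1
  | Proj n i => fun v y => y = tnth v i
  | Comp m n f g => fun v y =>
      exists2 w : m.-tuple nat,
        forall i, computes (g i) v (tnth w i) & computes f w y
  | Prec n f g => fun v y =>
      let p : n.-tuple nat := [tuple of behead v] in
      exists s : nat -> nat,
        [/\ computes f p (s 0),
            forall k, k < thead v ->
              computes g [tuple of k :: s k :: p] (s k.+1)
          & y = s (thead v)]
  | Mu n f => fun v y =>
      computes f [tuple of y :: v] 0 /\
      forall k, k < y -> exists z, computes f [tuple of k :: v] z.+1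
  end.

(* The algorithm must halt on the codes of any two calculi over [S], with
   output 1 or 0; nothing is required on other inputs. *)
Definition decides_expressibility (S : signature) (d : murec 2) : Prop :=
  forall P1 P2 : calculus S,
    exists2 b : bool,
      computes d [tuple code_calculus P1; code_calculus P2] b
      & (b <-> calc_le P1 P2).

(* Main.v *)
Require Import Defs.
From Stdlib Require Import Setoid.
From HB Require Import structures.
From mathcomp Require Import all_boot.
Set Implicit Arguments.
Unset Strict Implicit.
Unset Printing Implicit Defensive.

(** The proof is a diagonal argument in the style of Goedel.  A formula [A] is
derivable in [P] iff [calc_le [:: A] P] holds ([calc_le_sing]),
so a decider for expressibility decides derivability.  To each recursive
function [D] is attached a calculus in which a formula saying that [D] has
value [y] at [m] is derivable iff it is true.  If [d] decides expressibility,
let [D] be the function that, given the code [m] of a calculus [P], asks [d]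
whether the formula saying that [D] has value 0 at [m] is derivable in [P].
This formula does not mention [D] itself, which is always the function that
the calculus is about, so no fixed point theorem is needed.  For [m] the code
of the calculus of [D], the answer 1 would make [D m] both 1 and 0, and the
answer 0 makes [D m = 0] true, hence derivable, against the answer.

The calculus is obtained in two stages.  First, the graph of a recursive
function, together with the graphs of all its subterms, is the least model of
a Horn program over the natural numbers: [computes_model] and [sem_model].
Second, the facts derivable from a Horn program, written as an implicational
calculus, are those of its least model.

One inclusion ([derivable_model]) is a derivation in the calculus.  Variables
can only be replaced by derivable formulas, and so all numerals are made
derivable: the axioms contain zero, and the successor of a variable.  A clause
is an implication between facts; superposition instantiates its variables
by numerals, and modus ponens applies it.

The other inclusion ([derivable_fact]) needs an invariant of derivability.
Formulas are evaluated in an algebra of binary trees, in which implication is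
pairing, except that it sends a pair [(Node t t, t)] to the leaf; the formula
[(x -> x) -> x] is thereby a constant, from which all the syntax of numerals
and facts is built so that it can be read off from the value.  A tree is true
if it is a true fact, and otherwise by the usual reading of implication. *)

(** * Substitution *)

Fixpoint inst (S : signature) (th : nat -> form S) (A : form S) : form S :=
  match A with
  | Var x => th x
  | Con c f => Con c [ffun i => inst th (f i)]
  end.

Lemma subst_Imp (S : signature) x (B A C : form S) :
  subst x B (Imp A C) = Imp (subst x B A) (subst x B C).
Proof. by congr Con; apply/ffunP=> i; rewrite !ffunE; case: ifP. Qed.

Lemma inst_Imp (S : signature) th (A C : form S) :
  inst th (Imp A C) = Imp (inst th A) (inst th C).
Proof. by congr Con; apply/ffunP=> i; rewrite !ffunE; case: ifP. Qed.

Lemma inst_Var (S : signature) (A : form S) : inst Var A = A.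
Proof. by elim: A => //= c f IH; congr Con; apply/ffunP=> i; rewrite ffunE. Qed.

Lemma subst_inst (S : signature) x (B : form S) th A :
  subst x B (inst th A) = inst (fun y => subst x B (th y)) A.
Proof.
by elim: A => //= c f IH; congr Con; apply/ffunP=> i; rewrite !ffunE.
Qed.

Lemma eq_inst (S : signature) (th th' : nat -> form S) A :
  th =1 th' -> inst th A = inst th' A.
Proof.
move=> E; elim: A => //= c f IH.
by congr Con; apply/ffunP=> i; rewrite !ffunE.
Qed.

(** Only the finitely many variables of [A] matter, which is what reduces a
simultaneous substitution to a succession of single ones. *)
Lemma inst_finite (S : signature) (A : form S) :
  exists k, forall th th' : nat -> form S,
    (forall x, x <= k -> th x = th' x) -> inst th A = inst th' A.
Proof.
elim: A => [x | c f /fin_all_exists[k Hk]]; first by exists x => th th'; apply.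
exists (\max_i k i) => th th' E /=; congr Con; apply/ffunP=> i; rewrite !ffunE.
by apply: Hk => x le_x; apply/E/(leq_trans le_x)/leq_bigmax.
Qed.

(** The variables are replaced one at a time, in increasing order; since the
[th x] contain no variable other than [Var 0], the later replacements do not
disturb the earlier ones. *)
Lemma derivable_inst (S : signature) (P : calculus S) th A :
    th 0 = Var 0 ->
    (forall x, derivable P (th x.+1)) ->
    (forall x y B, subst y.+1 B (th x) = th x) ->
  derivable P A -> derivable P (inst th A).
Proof.
move=> th0 dth cth dA; have [k Hk] := inst_finite A.
(* [eta j] is [th] on the variables up to [j] and leaves the others alone. *)
pose eta j x := if x <= j then th x else Var x.
rewrite -(Hk (eta k)); last by move=> x le_x; rewrite /eta le_x.
elim: k {Hk} => [|k IH].
  rewrite (@eq_inst _ _ Var) ?inst_Var // => -[|x] //.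
rewrite (@eq_inst _ _ (fun x => subst k.+1 (th k.+1) (eta k x))).
  by rewrite -subst_inst; apply: der_superposition.
move=> x; rewrite /eta; case: (ltngtP x k.+1) => [lt_x|gt_x|->].
- by rewrite -ltnS lt_x cth.
- by rewrite leqNgt (ltnW gt_x) /= gtn_eqF.
- by rewrite ltnn /= eqxx.
Qed.

Lemma calc_le_sing (S : signature) (P : calculus S) A :
  calc_le [:: A] P <-> derivable P A.
Proof.
split=> [|dA B]; first by apply; apply: der_axiom; rewrite mem_head.
elim=> {B} [B | B C _ ? _ | x B C _ ? _ | x y B _].
- by rewrite inE => /eqP->.
- exact: der_mp.
- exact: der_superposition.
- exact: der_rename.
Qed.

(** * Horn programs over the natural numbers *)

(** A pair [(k, o)] stands for the variable [o] plus [k], or for [k] if there is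
no variable; the encoding by pairs gives decidable equality for free. *)
Definition term : Type := nat * option nat.

Definition lit n : term := (n, None).
Definition var x : term := (0, Some x).
Definition svar x : term := (1, Some x).

Definition tmval (r : nat -> nat) (t : term) : nat :=
  t.1 + oapp r 0 t.2.

(** A clause is its list of premises and its conclusion.  An atom is just a list
of terms: what would be the predicate symbol is a prefix of that list. *)
Definition clause : Type := seq (seq term) * seq term.

Definition holds (I : seq nat -> Prop) (C : clause) : Prop :=
  forall r, foldr (fun p X => I (map (tmval r) p) -> X)
                  (I (map (tmval r) C.2)) C.1.

Definition models (I : seq nat -> Prop) (Q : seq clause) : Prop :=
  forall C, C \in Q -> holds I C.

Lemma models_cons I C Q : models I (C :: Q) <-> holds I C /\ models I Q.
Proof.
split=> [IQ | [IC IQ] D /predU1P[-> // | /IQ //]].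
by split=> [|D QD]; apply: IQ; rewrite inE ?eqxx ?QD ?orbT.
Qed.

Lemma models_cat I Q R : models I (Q ++ R) <-> models I Q /\ models I R.
Proof.
split=> [IQR | [IQ IR] C]; last by rewrite mem_cat => /orP[/IQ | /IR].
by split=> C QC; apply: IQR; rewrite mem_cat QC ?orbT.
Qed.

Lemma foldr_impl (T : eqType) (F : T -> Prop) (X : Prop) s :
  foldr (fun p Y => F p -> Y) X s <-> ((forall p, p \in s -> F p) -> X).
Proof.
elim: s => [|a s IH] /=; first by split=> [//|]; apply.
split=> [H Fs | H Fa].
  by apply: (IH.1 (H (Fs a (mem_head _ _)))) => p sp; apply/Fs/mem_behead.
by apply/IH => Fs; apply: H => p /predU1P[-> | /Fs].
Qed.

(** * Horn programs as calculi *)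

(** This formula takes the same value under all valuations in the trees below.
The simpler [x -> x] would not do: making it constant would also collapse an
instance of a clause whose premise and conclusion coincide. *)
Definition cst (S : signature) : form S := Imp (Imp (Var 0) (Var 0)) (Var 0).
Definition zeroF (S : signature) : form S := Imp (cst S) (cst S).
Definition succF (S : signature) (A : form S) : form S :=
  Imp (cst S) (Imp (cst S) A).
Definition num (S : signature) n : form S := iter n (@succF S) (zeroF S).
Definition list_form (S : signature) (s : seq (form S)) : form S :=
  foldr (fun A l => Imp (Imp (cst S) A) l) (zeroF S) s.
Definition atom (S : signature) (s : seq (form S)) : form S :=
  Imp (cst S) (Imp (zeroF S) (list_form s)).

Definition term_form (S : signature) (t : term) : form S :=
  iter t.1 (@succF S) (oapp (fun x => Var x.+1) (zeroF S) t.2).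
Definition clause_form (S : signature) (C : clause) : form S :=
  foldr (fun p A => Imp (atom (map (term_form S) p)) A)
        (atom (map (term_form S) C.2)) C.1.

(** The first two axioms make the numerals derivable, so that superposition may
replace variables by them. *)
Definition program_calculus (S : signature) (Q : seq clause) : calculus S :=
  [:: zeroF S, succF (Var 1) & map (clause_form S) Q].

Definition fact (S : signature) (l : seq nat) : form S := atom (map (num S) l).

(** [Var 0] is reserved for the constant [cst], hence the shift. *)
Definition ground (S : signature) (r : nat -> nat) (x : nat) : form S :=
  if x is y.+1 then num S (r y) else Var 0.

Lemma subst_succF (S : signature) x (A B : form S) :
  subst x.+1 B (succF A) = succF (subst x.+1 B A).
Proof. by rewrite /succF /cst !subst_Imp. Qed.

Lemma inst_succF (S : signature) r (A : form S) :
  inst (ground S r) (succF A) = succF (inst (ground S r) A).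
Proof. by rewrite /succF /cst !inst_Imp. Qed.

Lemma inst_zeroF (S : signature) r : inst (ground S r) (zeroF S) = zeroF S.
Proof. by rewrite /zeroF /cst !inst_Imp. Qed.

Lemma subst_num (S : signature) x B n : subst x.+1 B (num S n) = num S n.
Proof.
elim: n => [|n IH]; first by rewrite /num /zeroF /cst !subst_Imp.
by rewrite [num S n.+1]iterS subst_succF IH.
Qed.

Lemma inst_term (S : signature) r t :
  inst (ground S r) (term_form S t) = num S (tmval r t).
Proof.
case: t => k o; rewrite /term_form /tmval [RHS]iterD /=.
elim: k => [|k IH]; last by rewrite !iterS inst_succF IH.
by case: o => [x|] //; apply: inst_zeroF.
Qed.

Lemma inst_atom (S : signature) r p :
  inst (ground S r) (atom (map (term_form S) p)) = fact S (map (tmval r) p).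
Proof.
rewrite /fact /atom inst_Imp; congr Imp; first by rewrite /cst !inst_Imp.
rewrite inst_Imp inst_zeroF; congr Imp; elim: p => [|t p IH].
  exact: inst_zeroF.
rewrite [list_form _]/= [RHS]/= inst_Imp IH; congr Imp.
by rewrite inst_Imp inst_term /cst !inst_Imp.
Qed.

Lemma derivable_num (S : signature) Q n :
  derivable (program_calculus S Q) (num S n).
Proof.
elim: n => [|n IH]; first by apply: der_axiom; rewrite mem_head.
have -> : num S n.+1 = subst 1 (num S n) (succF (Var 1)).
  by rewrite subst_succF.
by apply: der_superposition => //; apply: der_axiom; rewrite !inE eqxx orbT.
Qed.

(** Instantiate the clause, then detach its premises one by one. *)
Lemma derivable_model (S : signature) Q :
  models (fun l => derivable (program_calculus S Q) (fact S l)) Q.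
Proof.
move=> C QC r; have: derivable (program_calculus S Q)
                     (inst (ground S r) (clause_form S C)).
  apply: derivable_inst => // [x | [|x] y B |]; first exact: derivable_num.
  - by [].
  - exact: subst_num.
  - by apply: der_axiom; rewrite !inE map_f ?orbT.
rewrite /clause_form; elim: C.1 => [|p ps IH]; first by rewrite inst_atom.
rewrite [foldr _ _ _]/= inst_Imp inst_atom => dps dp.
exact/IH/(der_mp dp).
Qed.

(** * A model refuting the facts that do not follow *)

Inductive tree := Leaf | Node of tree & tree.

Lemma tree_comparable : comparable tree.
Proof. by rewrite /comparable /decidable; decide equality. Qed.

HB.instance Definition _ := hasDecEq.Build tree (compareP tree_comparable).

(** Pairing, except for the collapse [arrow (Node b b) b = Leaf] that makes
[(x -> x) -> x] constant. *)
Definition arrow (a b : tree) : tree :=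
  if a == Node b b then Leaf else Node a b.

Fixpoint eval (S : signature) (v : nat -> tree) (A : form S) : tree :=
  match A with
  | Var x => v x
  | Con c f =>
      let s := [seq eval v (f i) | i <- enum 'I_(arity c)] in
      if c == imp S then arrow (nth Leaf s 0) (nth Leaf s 1) else Leaf
  end.

Fixpoint tree_num (t : tree) : nat :=
  if t is Node Leaf (Node Leaf a) then (tree_num a).+1 else 0.

Fixpoint tree_seq (t : tree) : seq nat :=
  if t is Node (Node _ a) b then tree_num a :: tree_seq b else [::].

(** A tree [Node Leaf (Node (Node _ _) b)] is the fact about [tree_seq b]; the
other trees with left branch [Leaf], among them the numerals and the successors
of all trees, are true; the remaining nodes are implications.  Since [Leaf] is
false, the first two kinds are harmless for modus ponens: read as implications,
they have a premise that is never true. *)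
Fixpoint true_in (I : seq nat -> Prop) (t : tree) : Prop :=
  match t with
  | Leaf => False
  | Node Leaf (Node (Node _ _) b) => I (tree_seq b)
  | Node Leaf _ => True
  | Node a b => true_in I a -> true_in I b
  end.

Lemma eval_Imp (S : signature) v (A B : form S) :
  eval v (Imp A B) = arrow (eval v A) (eval v B).
Proof.
rewrite /Imp /= eqxx.
under eq_map => i do rewrite ffunE (fun_if (eval v)).
rewrite (map_comp (fun k => if k == 0 then eval v A else eval v B) val).
by rewrite val_enum_ord arity_imp.
Qed.

Lemma eval_subst (S : signature) v x (B A : form S) :
  eval v (subst x B A) = eval (fun y => if y == x then eval v B else v y) A.
Proof.
elim: A => [y | c f IH] /=; first by case: eqP.
by under eq_map => i do rewrite ffunE IH.
Qed.

(** In the collapsed case the implication is [Leaf], hence false. *)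
Lemma true_in_mp I a b : true_in I a -> true_in I (arrow a b) -> true_in I b.
Proof.
by rewrite /arrow; case: eqP => //; case: a => //= a a' _ ? /(_ _); apply.
Qed.

(** Validity under all valuations is closed under arbitrary substitution, in
particular under superposition and renaming. *)
Lemma derivable_true (S : signature) (P : calculus S) I :
    (forall A, A \in P -> forall v, true_in I (eval v A)) ->
  forall A, derivable P A -> forall v, true_in I (eval v A).
Proof.
move=> axP A.
elim=> {A} [A /axP // | A B _ IA _ IB v | x A B _ IA _ _ v | x y A _ IA v].
- by move: (IB v); rewrite eval_Imp; apply: true_in_mp.
- by rewrite eval_subst.
- by rewrite eval_subst.
Qed.

(** Trees are well founded; hence [x -> x] itself never collapses. *)
Lemma Node_neq (a b : tree) : (a == Node a b) = false.
Proof. by apply/eqP; elim: a b => [|a IH a1 _] b // [] /IH. Qed.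

Lemma arrow_Leaf b : arrow Leaf b = Node Leaf b.
Proof. by rewrite /arrow; case: eqP. Qed.

Lemma arrow_Node a b c :
  arrow (Node Leaf a) (Node b c) = Node (Node Leaf a) (Node b c).
Proof. by rewrite /arrow; case: eqP. Qed.

Lemma eval_cst (S : signature) v : eval v (cst S) = Leaf.
Proof. by rewrite /cst eval_Imp eval_Imp /arrow Node_neq eqxx. Qed.

Lemma eval_zeroF (S : signature) v : eval v (zeroF S) = Node Leaf Leaf.
Proof. by rewrite /zeroF eval_Imp eval_cst arrow_Leaf. Qed.

Lemma eval_succF (S : signature) v (A : form S) :
  eval v (succF A) = Node Leaf (Node Leaf (eval v A)).
Proof. by rewrite /succF eval_Imp eval_cst eval_Imp eval_cst !arrow_Leaf. Qed.

Lemma tree_num_term (S : signature) v t :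
  tree_num (eval v (term_form S t)) = tmval (fun x => tree_num (v x.+1)) t.
Proof.
case: t => k o; rewrite /term_form /tmval /=.
elim: k => [|k IH]; last by rewrite iterS eval_succF /= IH.
by case: o => [x|] //; rewrite eval_zeroF.
Qed.

(** The encoding of lists never collapses, since its value is never [Leaf]. *)
Lemma eval_list_form (S : signature) v s :
  exists a b, eval v (list_form s) = Node a b
    /\ tree_seq (Node a b) = [seq tree_num (eval v A) | A : form S <- s].
Proof.
elim: s => [|A s [a [b [E Es]]]].
  by exists Leaf, Leaf; rewrite eval_zeroF.
exists (Node Leaf (eval v A)), (Node a b); split; last by rewrite [RHS]/= -Es.
rewrite [list_form _]/= -/(list_form s).
by rewrite !(eval_Imp, eval_cst) E arrow_Leaf arrow_Node.
Qed.

Lemma eval_atom (S : signature) v s :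
  exists2 b, eval v (atom s) = Node Leaf (Node (Node Leaf Leaf) b)
    & tree_seq b = [seq tree_num (eval v A) | A : form S <- s].
Proof.
have [a [b [E Es]]] := eval_list_form v s; exists (Node a b) => //.
by rewrite /atom eval_Imp eval_cst eval_Imp eval_zeroF E arrow_Node arrow_Leaf.
Qed.

(** The axioms are valid.  For a clause this is its truth in [I] at the numbers
that [tree_num] reads off from the values of the variables, whatever these
values are.  A clause never collapses, since the value of its first premise has
left branch [Leaf] and another right branch. *)
Lemma derivable_fact (S : signature) Q I :
    models I Q ->
  forall l, derivable (program_calculus S Q) (fact S l) -> I l.
Proof.
move=> IQ l dl.
have fact_true v s : true_in I (eval v (atom s))
    = I [seq tree_num (eval v A) | A : form S <- s].
  by have [b -> <-] := eval_atom v s.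
suff: true_in I (eval (fun=> Leaf) (fact S l)).
  rewrite fact_true -map_comp map_id_in // => n _ /=.
  elim: n => [|n IH]; first by rewrite eval_zeroF.
  by rewrite [num _ _]iterS eval_succF /= IH.
apply: (derivable_true _ dl) => A; rewrite !inE.
case/or3P=> [/eqP-> v | /eqP-> v | /mapP[C QC ->] v].
- by rewrite eval_zeroF.
- by rewrite eval_succF.
have /= := IQ C QC (fun x => tree_num (v x.+1)).
have term_true p : true_in I (eval v (atom (map (term_form S) p)))
    = I (map (tmval (fun x => tree_num (v x.+1))) p).
  rewrite fact_true -map_comp; congr I.
  by apply: eq_map => t /=; apply: tree_num_term.
rewrite /clause_form; elim: C.1 => [|p ps IH] Ips; first by rewrite term_true.
rewrite [foldr _ _ _]/= eval_Imp.
have [b E _] := eval_atom v (map (term_form S) p).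
have := term_true p; rewrite E /arrow => Ep.
case: eqP => [[<-] // | _].
(* The implication from a fact unfolds to one from the truth of this fact. *)
change (true_in I (Node Leaf (Node (Node Leaf Leaf) b)) ->
  true_in I (eval v (foldr (fun p A => Imp (atom (map (term_form S) p)) A)
                      (atom (map (term_form S) C.2)) ps))).
rewrite Ep => Ip; exact/IH/Ips.
Qed.

(** * Recursive functions as Horn programs *)

Definition vars m n : seq term := map var (iota m n).

Definition at_pos (p : seq nat) (s : seq term) : seq term := map lit p ++ s.

Definition result (p : seq nat) (y : term) (s : seq term) : seq term :=
  at_pos p [:: lit 0, y & s].

(** The prefix [p] is the position of the subterm [f] in the whole program:
1 leads to the outer function of a composition, to the base function of a
primitive recursion or to the minimized function, [i.+2] to the [i]-th inner
function of a composition, 2 to the step function of a primitive recursion, and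
0 ends the position, so that positions form a prefix code.  The atom
[p, 0, y, s] says that the subterm at [p] has value [y] at [s].  Below a
minimization, position 2 is used for an auxiliary predicate: [p, 2, k, s] says
that the minimized function has nonzero values at all arguments below [k].

The arguments of [f] are the variables 0 to [n.-1]; the further variables of a
clause are numbered from [n] on. *)
Fixpoint horn n (f : murec n) (p : seq nat) : seq clause :=
  match f with
  | Zero => [:: ([::], result p (lit 0) [::])]
  | Succ => [:: ([::], result p (svar 0) [:: var 0])]
  | Proj n i => [:: ([::], result p (var i) (vars 0 n))]
  | Comp m n f g =>
      (result (rcons p 1) (var (n + m)) (vars n m)
         :: [seq result (rcons p (val i).+2) (var (n + val i)) (vars 0 n)
            | i : 'I_m <- enum 'I_m],
       result p (var (n + m)) (vars 0 n))
      :: horn f (rcons p 1)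
      ++ flatten [seq horn (g i) (rcons p (val i).+2) | i : 'I_m <- enum 'I_m]
  | Prec n f g =>
      let k := var n in let s := var n.+1 in let y := var n.+2 in
      [:: ([:: result (rcons p 1) y (vars 0 n)],
           result p y (lit 0 :: vars 0 n)),
          ([:: result p s (k :: vars 0 n);
               result (rcons p 2) y [:: k, s & vars 0 n]],
           result p y (svar n :: vars 0 n))
        & horn f (rcons p 1) ++ horn g (rcons p 2)]
  | Mu n f =>
      let k := var n in
      [:: ([::], at_pos (rcons p 2) (lit 0 :: vars 0 n)),
          ([:: at_pos (rcons p 2) (k :: vars 0 n);
               result (rcons p 1) (svar n.+1) (k :: vars 0 n)],
           at_pos (rcons p 2) (svar n :: vars 0 n)),
          ([:: at_pos (rcons p 2) (k :: vars 0 n);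
               result (rcons p 1) (lit 0) (k :: vars 0 n)],
           result p k (vars 0 n))
        & horn f (rcons p 1)]
  end.

Definition graph n (f : murec n) (y : nat) (s : seq nat) : Prop :=
  exists2 v : n.-tuple nat, val v = s & computes f v y.

Definition positive_below n (f : murec n.+1) (k : nat) (s : seq nat) : Prop :=
  exists2 v : n.-tuple nat, val v = s
    & forall j, j < k -> exists z, computes f [tuple of j :: v] z.+1.

(** The intended meaning of the atoms, which reads the position from the list
and descends in [f] accordingly. *)
Fixpoint sem n (f : murec n) (l : seq nat) : Prop :=
  match l with
  | [:: 0, y & s] => graph f y s
  | i.+1 :: l' =>
      match f with
      | Comp m n f g =>
          if i is j.+1 then exists lt_j : j < m, sem (g (Ordinal lt_j)) l'
          else sem f l'
      | Prec n f g =>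
          match i with 0 => sem f l' | 1 => sem g l' | _ => False end
      | Mu n f =>
          match i, l' with
          | 0, _ => sem f l'
          | 1, k :: s => positive_below f k s
          | _, _ => False
          end
      | _ => False
      end
  | _ => False
  end.

Lemma sem_graph n (f : murec n) y s : sem f [:: 0, y & s] = graph f y s.
Proof. by case: f. Qed.

Lemma graph_tuple n (f : murec n) y (v : n.-tuple nat) :
  graph f y v <-> computes f v y.
Proof. by split=> [[w /val_inj->] | ] //; exists v. Qed.

Lemma tmval_at_pos r p s : map (tmval r) (at_pos p s) = p ++ map (tmval r) s.
Proof.
rewrite /at_pos map_cat -map_comp map_id_in // => n _.
by rewrite /tmval /= addn0.
Qed.

Definition window (r : nat -> nat) m n : n.-tuple nat :=
  [tuple of mkseq (fun i => r (m + i)) n].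

Lemma tmval_vars r m n : map (tmval r) (vars m n) = window r m n.
Proof.
rewrite /vars -map_comp /= /mkseq -[X in iota X n]addn0 iotaDl -map_comp.
exact: eq_map.
Qed.

Lemma model_result n (f : murec n) p I r y s :
    (forall l, I (p ++ l) <-> sem f l) ->
  I (map (tmval r) (result p y s)) <->
  graph f (tmval r y) (map (tmval r) s).
Proof. by move=> If; rewrite tmval_at_pos If /= sem_graph. Qed.

Lemma behead_cons_tuple n k (v : n.-tuple nat) :
  [tuple of behead [tuple of k :: v]] = v.
Proof. exact: val_inj. Qed.

(** At an argument given as a cons, the head and the tail in the definition of
[computes] can be replaced by the components, although the type of the tail
depends on it. *)
Lemma computes_Prec n (f : murec n) g k (v : n.-tuple nat) y :
  computes (Prec f g) [tuple of k :: v] y =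
  exists s : nat -> nat,
    [/\ computes f v (s 0),
        forall j, j < k -> computes g [tuple of j :: s j :: v] (s j.+1)
      & y = s k].
Proof.
pose G (w : n.-tuple nat) := exists s : nat -> nat,
  [/\ computes f w (s 0),
      forall j, j < k -> computes g [tuple of j :: s j :: w] (s j.+1)
    & y = s k].
have -> : computes (Prec f g) [tuple of k :: v] y
          = G [tuple of behead [tuple of k :: v]] by [].
by rewrite behead_cons_tuple.
Qed.

(** The program is sound: its clauses are instances of the definition of
[computes]. *)
Lemma sem_model n (f : murec n) p I :
    (forall l, I (p ++ l) <-> sem f l) ->
  models I (horn f p).
Proof.
elim: f p => [||n' i|m n' f IHf g IHg|n' f IHf g IHg|n' f IHf] p Ip C /=.
- rewrite inE => /eqP-> r; apply/(model_result _ _ _ Ip).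
  by exists [tuple].
- rewrite inE => /eqP-> r; apply/(model_result _ _ _ Ip).
  by exists [tuple r 0].
- rewrite inE => /eqP-> r; apply/(model_result _ _ _ Ip).
  rewrite tmval_vars; apply/graph_tuple => /=.
  by rewrite (tnth_nth 0) /= nth_mkseq.
- have If l : I (rcons p 1 ++ l) <-> sem f l by rewrite cat_rcons Ip.
  have Ig (i : 'I_m) l : I (rcons p (val i).+2 ++ l) <-> sem (g i) l.
    rewrite cat_rcons Ip /=; split=> [[lt_i] | semi].
      by rewrite (_ : Ordinal lt_i = i) //; apply: val_inj.
    by exists (ltn_ord i); rewrite (_ : Ordinal _ = i) //; apply: val_inj.
  rewrite inE mem_cat => /or3P[/eqP-> r | Cf | /flatten_mapP[i _ Cg]];
    last 2 first.
  - exact: IHf Cf.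
  - exact: IHg (Ig i) _ Cg.
  move/(model_result _ _ _ If); rewrite tmval_vars => -[w Ew fw].
  apply/foldr_impl => Hg; apply/(model_result _ _ _ Ip).
  rewrite tmval_vars; apply/graph_tuple; exists w => // i.
  have := Hg _ (map_f _ (mem_enum _ i)).
  move/(model_result _ _ _ (Ig i)); rewrite tmval_vars => /graph_tuple.
  by rewrite (tnth_nth 0) Ew /= nth_mkseq.
- have If l : I (rcons p 1 ++ l) <-> sem f l by rewrite cat_rcons Ip.
  have Ig l : I (rcons p 2 ++ l) <-> sem g l by rewrite cat_rcons Ip.
  rewrite !inE mem_cat => /or4P[/eqP-> r | /eqP-> r | Cf | Cg]; last 2 first.
  - exact: IHf Cf.
  - exact: IHg Cg.
  - move/(model_result _ _ _ If); rewrite tmval_vars => /graph_tuple fv.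
    apply/(model_result _ _ _ Ip); rewrite /= tmval_vars.
    set v := window _ _ _ in fv *; exists [tuple of 0 :: v] => //.
    rewrite computes_Prec.
    by exists (fun=> r n'.+2).
  - move/(model_result _ _ _ Ip); rewrite /= tmval_vars.
    set v := window _ _ _ => -[u Eu].
    have {u Eu}-> : u = [tuple of r n' :: v] by apply: val_inj.
    rewrite computes_Prec => -[s [s0 Hs Es]].
    move/(model_result _ _ _ Ig); rewrite /= tmval_vars -/v => -[w Ew gw].
    apply/(model_result _ _ _ Ip); rewrite /= tmval_vars -/v.
    exists [tuple of (r n').+1 :: v] => //; rewrite computes_Prec.
    (* The old course of values, prolonged by the value of the last step. *)
    exists (fun k => if k <= r n' then s k else r n'.+2); split=> // [k|].
      rewrite ltnS => le_k; rewrite le_k; case: ltngtP le_k => // [lt_k | Ek] _.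
        exact: Hs.
      move: gw; congr computes; apply: val_inj; rewrite Ew /= Ek -Es //.
    by rewrite ltnn.
- have If l : I (rcons p 1 ++ l) <-> sem f l by rewrite cat_rcons Ip.
  have Ib k s : I (rcons p 2 ++ k :: s) <-> positive_below f k s.
    by rewrite cat_rcons Ip.
  rewrite !inE => /or4P[/eqP-> r | /eqP-> r | /eqP-> r | Cf]; last first.
  - exact: IHf Cf.
  - rewrite /= tmval_at_pos /= Ib tmval_vars => -[v Ev Hv].
    move/(model_result _ _ _ If); rewrite /= tmval_vars => -[u Eu fu].
    apply/(model_result _ _ _ Ip); rewrite tmval_vars -Ev; apply/graph_tuple.
    split=> //; move: fu; congr computes.
    by apply: val_inj; rewrite Eu /= Ev.
  - rewrite /= tmval_at_pos /= Ib tmval_vars => -[v Ev Hv].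
    move/(model_result _ _ _ If); rewrite /= tmval_vars => -[u Eu fu].
    rewrite tmval_at_pos /= Ib tmval_vars.
    exists v => // j; rewrite ltnS leq_eqVlt => /predU1P[-> | /Hv //].
    exists (r n'.+1); move: fu; congr computes.
    by apply: val_inj; rewrite Eu /= Ev.
  - rewrite /= tmval_at_pos /= Ib tmval_vars.
    by exists (window r 0 n').
Qed.

Lemma tmval_vars_nth r m n (w : n.-tuple nat) :
    (forall i, i < n -> r (m + i) = nth 0 w i) ->
  map (tmval r) (vars m n) = w.
Proof.
move=> E; rewrite tmval_vars; apply: (@eq_from_nth _ 0).
  by rewrite !size_tuple.
by move=> i; rewrite size_tuple => lt_i; rewrite nth_mkseq // E.
Qed.

Lemma nth_cat_tuple n (v : n.-tuple nat) s i :
  nth 0 (v ++ s) (n + i) = nth 0 s i.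
Proof. by rewrite nth_cat size_tuple ltnNge leq_addr addKn. Qed.

(** The program is complete: every model contains the graph of [f].  In each
case the clause is used at the valuation that lists the arguments of [f]
followed by the intermediate values of the computation. *)
Lemma computes_model n (f : murec n) p I :
    models I (horn f p) ->
  forall v y, computes f v y -> I (p ++ [:: 0, y & v]).
Proof.
elim: f p => [||n' i|m n' f IHf g IHg|n' f IHf g IHg|n' f IHf] p /=.
- case/models_cons=> Ip _ v _ ->; have := Ip id.
  by rewrite /= tmval_at_pos (tuple0 v).
- case/models_cons=> Ip _ v _ ->; have := Ip (nth 0 v).
  by case/tupleP: v => x v; rewrite /= tmval_at_pos (tuple0 v).
- case/models_cons=> Ip _ v _ ->; have := Ip (nth 0 v).
  by rewrite /= tmval_at_pos /= (tmval_vars_nth (w := v)) // (tnth_nth 0).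
- case/models_cons=> Ip /models_cat[Ipf Ipg] v y [w gw fw].
  pose r := nth 0 (v ++ w ++ [:: y]).
  have rv : map (tmval r) (vars 0 n') = v.
    by apply: tmval_vars_nth => i lt_i; rewrite /r nth_cat size_tuple lt_i.
  have rw i : i < m -> r (n' + i) = nth 0 w i.
    by move=> lt_i; rewrite /r nth_cat_tuple nth_cat size_tuple lt_i.
  have ry : r (n' + m) = y.
    rewrite /r nth_cat_tuple.
    by have := nth_cat_tuple w [:: y] 0; rewrite addn0.
  have := Ip r; rewrite /= !tmval_at_pos /= rv (tmval_vars_nth rw).
  rewrite /tmval /= !add0n ry; move/(_ (IHf _ Ipf _ _ fw))/foldr_impl; apply.
  move=> q /mapP[i _ ->]; rewrite tmval_at_pos /= rv /tmval /= !add0n rw //.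
  rewrite -tnth_nth; apply: (IHg i) (gw i) => C Cg; apply: Ipg.
  by apply/flatten_mapP; exists i; rewrite ?mem_enum.
- case/models_cons=> Ip0 /models_cons[IpS /models_cat[Ipf Ipg]] v y.
  case/tupleP: v => k v dfg.
  have: computes (Prec f g) [tuple of k :: v] y by [].
  rewrite computes_Prec => {dfg} -[s [s0 Hs ->]].
  pose r a b c := nth 0 (v ++ [:: a; b; c]).
  have rv a b c : map (tmval (r a b c)) (vars 0 n') = v.
    by apply: tmval_vars_nth => i lt_i; rewrite /r nth_cat size_tuple lt_i.
  have rE a b c : [/\ r a b c n' = a, r a b c n'.+1 = b & r a b c n'.+2 = c].
    have E i := nth_cat_tuple v [:: a; b; c] i.
    by move: (E 0) (E 1) (E 2); rewrite addn0 addn1 addn2.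
  elim: k Hs => [|k IH] Hs.
    have := Ip0 (r 0 0 (s 0)); have [_ _ ry] := rE 0 0 (s 0).
    rewrite /= !tmval_at_pos /= rv /tmval /= ry; apply.
    exact: IHf Ipf _ _ s0.
  have := IpS (r k (s k) (s k.+1)).
  have [rk rs ry] := rE k (s k) (s k.+1).
  rewrite /= !tmval_at_pos /= rv /tmval /= rk rs ry; apply.
    by apply: IH => j lt_j; apply: Hs; apply: ltnW.
  by have := IHg _ Ipg _ _ (Hs k (ltnSn k)).
- case/models_cons=> Ip0 /models_cons[IpS /models_cons[Ip Ipf]] v y [fy Hy].
  pose r a b := nth 0 (v ++ [:: a; b]).
  have rv a b : map (tmval (r a b)) (vars 0 n') = v.
    by apply: tmval_vars_nth => i lt_i; rewrite /r nth_cat size_tuple lt_i.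
  have rE a b : r a b n' = a /\ r a b n'.+1 = b.
    have E i := nth_cat_tuple v [:: a; b] i.
    by move: (E 0) (E 1); rewrite addn0 addn1.
  have below k : k <= y -> I (rcons p 2 ++ k :: v).
    elim: k => [|k IH] lt_k.
      have := Ip0 (r 0 0).
      by rewrite /= tmval_at_pos /= rv.
    have [z fz] := Hy k lt_k.
    have := IpS (r k z); have [rk rz] := rE k z.
    rewrite /= !tmval_at_pos /= rv /tmval /= rk rz; apply; first exact/IH/ltnW.
    by have := IHf _ Ipf _ _ fz.
  have := Ip (r y 0).
  have [ry _] := rE y 0.
  rewrite /= !tmval_at_pos /= rv /tmval /= ry; apply; first exact: below.
  by have := IHf _ Ipf _ _ fy.
Qed.

(** * Arithmetic of codes *)

Lemma computes_fun n (f : murec n) v y y' :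
  computes f v y -> computes f v y' -> y = y'.
Proof.
elim: f v y y' => [||n' i|m n' f IHf g IHg|n' f IHf g IHg|n' f IHf] v y y' /=.
- by move=> -> ->.
- by move=> -> ->.
- by move=> -> ->.
- case=> w gw fw [w' gw' fw']; have Ew : w = w'.
    by apply: eq_from_tnth => i; apply: IHg (gw i) (gw' i).
  by move: fw'; rewrite -Ew; apply: IHf.
- case=> s [s0 Hs ->] [s' [s0' Hs' ->]].
  elim: (thead v) Hs Hs' => [|k IH] Hs Hs'; first exact: IHf s0 s0'.
  have Ek : s k = s' k.
    by apply: IH => j lt_j; [apply: Hs | apply: Hs']; apply: ltnW.
  by have := Hs' k (ltnSn k); rewrite -Ek; apply: IHg (Hs k (ltnSn k)).
- case=> fy Hy [fy' Hy']; case: (ltngtP y y') => // [/Hy' | /Hy] [z fz].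
    by have := IHf _ _ _ fy fz.
  by have := IHf _ _ _ fy' fz.
Qed.

(** Total functions only: they suffice to compute the codes of formulas. *)
Definition recursive n (F : n.-tuple nat -> nat) : Prop :=
  exists f : murec n, forall v, computes f v (F v).

Lemma recursive_proj n (i : 'I_n) : recursive (fun v => tnth v i).
Proof. by exists (Proj i). Qed.

Lemma recursive_comp m n (F : m.-tuple nat -> nat)
    (G : 'I_m -> n.-tuple nat -> nat) :
    recursive F -> (forall i, recursive (G i)) ->
  recursive (fun v => F [tuple G i v | i < m]).
Proof.
move=> [f fF] /fin_all_exists[g gG]; exists (Comp f g) => v.
by exists [tuple G i v | i < m] => // i; rewrite tnth_mktuple.
Qed.

Lemma recursive_comp1 n (F : nat -> nat) (G : n.-tuple nat -> nat) :
    recursive (fun v : 1.-tuple nat => F (thead v)) -> recursive G ->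
  recursive (fun v => F (G v)).
Proof.
move=> rF rG; have [f fF] := recursive_comp rF (fun _ : 'I_1 => rG).
by exists f => v; have := fF v; rewrite /thead tnth_mktuple.
Qed.

Lemma recursive_comp2 n (F : nat -> nat -> nat) (G H : n.-tuple nat -> nat) :
    recursive (fun v : 2.-tuple nat => F (thead v) (tnth v ord_max)) ->
    recursive G -> recursive H ->
  recursive (fun v => F (G v) (H v)).
Proof.
move=> rF rG rH.
have [i|f fF] := @recursive_comp _ _ _ (fun i => if i == ord0 then G else H) rF.
  by case: ifP.
by exists f => v; have := fF v; rewrite /thead !tnth_mktuple.
Qed.

Lemma recursive_succ n (G : n.-tuple nat -> nat) :
  recursive G -> recursive (fun v => (G v).+1).
Proof. by apply: recursive_comp1; exists Succ. Qed.

Lemma recursive_const n k : recursive (fun _ : n.-tuple nat => k).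
Proof.
elim: k => [|k]; last exact: recursive_succ.
have g : 'I_0 -> murec n by case.
by exists (Comp Zero g) => v; exists [tuple] => // -[].
Qed.

Lemma recursive_prec n (F : n.-tuple nat -> nat)
    (G : nat -> nat -> n.-tuple nat -> nat)
    (H : nat -> n.-tuple nat -> nat) :
    recursive F ->
    recursive (fun v : n.+2.-tuple nat =>
                 G (thead v) (tnth v (lift ord0 ord0))
                   [tuple of behead [tuple of behead v]]) ->
    (forall v, H 0 v = F v) -> (forall k v, H k.+1 v = G k (H k v) v) ->
  recursive (fun v : n.+1.-tuple nat => H (thead v) [tuple of behead v]).
Proof.
move=> [f fF] [g gG] H0 HS; exists (Prec f g) => v.
exists (fun k => H k [tuple of behead v]); split=> // [|k _].
  by rewrite H0.
rewrite HS; set w := [tuple of behead v].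
have := gG [tuple of k :: H k w :: w].
by congr computes; congr G; apply: val_inj.
Qed.

Lemma recursive_add n (G H : n.-tuple nat -> nat) :
  recursive G -> recursive H -> recursive (fun v => G v + H v).
Proof.
apply: recursive_comp2.
have [f fE] :
    recursive (fun v : 2.-tuple nat => thead v + thead [tuple of behead v]).
  apply: (@recursive_prec 1 (@thead 0 nat) (fun _ s _ => s.+1)
           (fun k v => k + thead v)) => //.
    exact: recursive_proj.
  exact/recursive_succ/recursive_proj.
exists f => v; have := fE v; congr (computes _ _ (_ + _)).
by case/tupleP: v => x v; case/tupleP: v => y v.
Qed.

Lemma recursive_mul n (G H : n.-tuple nat -> nat) :
  recursive G -> recursive H -> recursive (fun v => G v * H v).
Proof.
apply: recursive_comp2.
have [f fE] :
    recursive (fun v : 2.-tuple nat => thead v * thead [tuple of behead v]).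
  apply: (@recursive_prec 1 (fun=> 0) (fun _ s v => thead v + s)
           (fun k v => k * thead v)) => //.
    exact: recursive_const.
  apply: recursive_add; last exact: recursive_proj.
  have [g gE] := @recursive_proj 3 ord_max; exists g => v; have := gE v.
  congr computes.
  by case/tupleP: v => x v; case/tupleP: v => y v; case/tupleP: v => z v.
exists f => v; have := fE v; congr (computes _ _ (_ * _)).
by case/tupleP: v => x v; case/tupleP: v => y v.
Qed.

Lemma recursive_npair n (G H : n.-tuple nat -> nat) :
  recursive G -> recursive H -> recursive (fun v => npair (G v) (H v)).
Proof.
move=> rG rH; apply: recursive_add => //; have rS := recursive_add rG rH.
exact: (recursive_mul rS rS).
Qed.

Lemma recursive_iter n (F : nat -> nat) c (G : n.-tuple nat -> nat) :
    recursive (fun v : 1.-tuple nat => F (thead v)) -> recursive G ->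
  recursive (fun v => iter (G v) F c).
Proof.
move=> rF; apply: recursive_comp1.
apply: (@recursive_prec 0 (fun=> c) (fun _ s _ => F s)
         (fun k _ => iter k F c)) => //.
  exact: recursive_const.
by apply: recursive_comp1 => //; apply: recursive_proj.
Qed.

Definition code_imp (S : signature) (a b : nat) : nat :=
  npair (enum_rank (imp S)).+1 (code_seq [:: a; b]).

Lemma code_Imp (S : signature) (A B : form S) :
  code (Imp A B) = code_imp S (code A) (code B).
Proof.
rewrite [LHS]/=; congr (npair _ (code_seq _)).
under eq_map => i do rewrite ffunE (fun_if (@code S)).
rewrite (map_comp (fun k => if k == 0 then code A else code B) val).
by rewrite val_enum_ord arity_imp.
Qed.

Lemma recursive_code_imp (S : signature) n (G H : n.-tuple nat -> nat) :
  recursive G -> recursive H -> recursive (fun v => code_imp S (G v) (H v)).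
Proof.
move=> rG rH; apply: recursive_npair; first exact: recursive_const.
apply/recursive_succ/recursive_npair => //.
by apply/recursive_succ/recursive_npair => //; apply: recursive_const.
Qed.

(** The head 0 is the position of the whole program, and the next 0 a value:
the formula says that the function of the calculus has value 0 at [m]. *)
Definition query (S : signature) (m : nat) : form S := fact S [:: 0; 0; m].

(** The numeral of [m] is an iterated successor, and the query is a fixed
context around it. *)
Lemma recursive_code_query (S : signature) :
  recursive (fun v : 1.-tuple nat => code_calculus [:: query S (thead v)]).
Proof.
have rnum : recursive (fun v : 1.-tuple nat => code (num S (thead v))).
  pose c := code (cst S).
  have [|f fE] := @recursive_iter 1 (fun a => code_imp S c (code_imp S c a))
                    (code (zeroF S)) (@thead 0 nat) _ (recursive_proj _).
    do 2![apply: recursive_code_imp; first exact: recursive_const].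
    exact: recursive_proj.
  exists f => v; have := fE v; congr computes; elim: (thead v) => // k IH.
  by rewrite iterS IH -!code_Imp.
pose c := code (cst S); pose z := code (zeroF S).
have [f fE] : recursive (fun v : 1.-tuple nat =>
  (npair (code_imp S c (code_imp S z
    (code_imp S (code_imp S c z) (code_imp S (code_imp S c z)
      (code_imp S (code_imp S c (code (num S (thead v)))) z))))) 0).+1).
  apply/recursive_succ/recursive_npair; last exact: recursive_const.
  by repeat (apply: recursive_code_imp || apply: recursive_const).
exists f => v; have := fE v; congr (computes _ _ (npair _ _).+1).
by rewrite -!code_Imp.
Qed.

(** * Diagonalization *)

Theorem mainTheorem2 (S : signature) :
  ~ exists d : murec 2, decides_expressibility S d.
Proof.
case=> d dP; have [e eE] := recursive_code_query S.
pose D := Comp d (fun i : 'I_2 => if i == ord0 then e else Proj ord0).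
pose Q := program_calculus S (horn D [::]); pose m := code_calculus Q.
have [b db bP] := dP [:: query S m] Q.
have Dm : computes D [tuple m] b.
  exists [tuple code_calculus [:: query S m]; m] => // i.
  by case: i => [[|[|//]] lt_i] //=; apply: eE [tuple m].
have qP : derivable Q (query S m) <-> computes D [tuple m] 0.
  split=> [/(@derivable_fact _ _ (sem D)) dD | D0].
    have /dD : models (sem D) (horn D [::]) by apply: sem_model.
    by rewrite sem_graph => /(graph_tuple D 0 [tuple m]).
  exact: (computes_model (@derivable_model S (horn D [::])) D0).
case: b {db} bP Dm => bP Dm.
  have /calc_le_sing/qP D0 : calc_le [:: query S m] Q by apply/bP.
  by have := computes_fun D0 Dm.
by have /bP : calc_le [:: query S m] Q by apply/calc_le_sing/qP.
Qed.
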